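(* Let $I \subset S = \mathbb{C}[x_1,\dots,x_r]$ be a homogeneous ideal generated in degrees $\le n$, and let $x^{J_1},\dots,x^{J_N}$ be the minimal generators of $\mathrm{gin}(I)$ of degree $\le n$. Then every minimal generator $P$ of $\mathrm{gin}(I)$ of degree $n+1$ satisfies $P \prec x_i x^{J_j}$ for some $j$ with $|J_j| = n$ and some index $i < \max(J_j)$.
   Context: $\mathrm{gin}(I)$ denotes the generic initial ideal of $I$ with respect to the reverse lexicographic order $\succ$ with $x_1 \succ x_2 \succ \cdots \succ x_r$ (the initial ideal of $I$ after a generic linear change of coordinates); it is a Borel-fixed monomial ideal. For an exponent vector $J = (j_1,\dots,j_r)$, $x^J = x_1^{j_1}\cdots x_r^{j_r}$, $|J| = j_1+\cdots+j_r$, and $\max(J) = \max\{ i \mid j_i > 0\}$. The symbol $\prec$ denotes comparison in the reverse lexicographic order. *)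

(* Defs.v *)
From HB Require Import structures.
From mathcomp Require Import all_boot all_order all_algebra.
From mathcomp Require Import complex.
From mathcomp Require Import Rstruct.
From mathcomp Require Import mpoly.
From Stdlib Require Rdefinitions.

Set Implicit Arguments.
Unset Strict Implicit.
Unset Printing Implicit Defensive.

Import GRing.Theory.
Local Open Scope ring_scope.

Definition CC : fieldType := complex Rdefinitions.R.

(* Exponent vectors J = (j_1,...,j_r), 0-indexed: J i = j_{i+1}. *)

(* Homogeneous of degree d (the zero polynomial is homogeneous of every degree). *)
Definition homogeneous_of (r d : nat) (p : {mpoly CC[r]}) : Prop :=
  forall m, m \in msupp p -> mdeg m = d.

Definition in_ideal (r : nat) (gs : seq {mpoly CC[r]}) (p : {mpoly CC[r]}) : Prop :=
  exists cs : seq {mpoly CC[r]},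
    p = \sum_(k < size gs) cs`_k * gs`_k.

(* Degree reverse lexicographic order with x_1 > x_2 > ... > x_r:
   revlex_lt a b  <->  x^a < x^b, i.e. |a| < |b|, or |a| = |b| and the
   last nonzero coordinate of a - b is positive. *)
Definition revlex_lt (r : nat) (a b : 'X_{1..r}) : Prop :=
  (mdeg a < mdeg b)%N \/
  (mdeg a = mdeg b /\
   exists k : 'I_r, (b k < a k)%N /\ forall l : 'I_r, (k < l)%N -> a l = b l).

Definition lead_mono (r : nat) (p : {mpoly CC[r]}) (m : 'X_{1..r}) : Prop :=
  m \in msupp p /\ forall m', m' \in msupp p -> m' <> m -> revlex_lt m' m.

(* Monomials of the initial ideal in(J) of the ideal J generated by gs:
   x^m is in in(J) iff it is the leading monomial of some element of J
   (in(J) is spanned by the leading monomials of elements of J, and it is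
   closed under multiplication by monomials since J is an ideal). *)
Definition in_initial (r : nat) (gs : seq {mpoly CC[r]}) (m : 'X_{1..r}) : Prop :=
  exists p, in_ideal gs p /\ lead_mono p m.

Definition lin_change (r : nat) (g : 'M[CC]_r) (p : {mpoly CC[r]}) : {mpoly CC[r]} :=
  p \mPo [tuple (\sum_(j < r) g i j *: 'X_j) | i < r].

(* M (a set of monomials, i.e. a monomial ideal) is the generic initial ideal
   of the ideal generated by gs: there is a nonempty Zariski open subset of
   GL_r(C), namely { g | det g <> 0, f(g) <> 0 } for a nonzero polynomial f in
   the r*r entries of g, on which in(g.I) = M. *)
Definition is_gin (r : nat) (gs : seq {mpoly CC[r]}) (M : 'X_{1..r} -> Prop) : Prop :=
  exists f : {mpoly CC[r * r]},
    f != 0 /\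
    forall g : 'M[CC]_r,
      g \in unitmx ->
      meval (fun k => mxvec g 0 k) f != 0 ->
      forall m, M m <-> in_initial (map (lin_change g) gs) m.

Definition mdivides (r : nat) (a b : 'X_{1..r}) : Prop := forall i : 'I_r, (a i <= b i)%N.

Definition min_gen (r : nat) (M : 'X_{1..r} -> Prop) (m : 'X_{1..r}) : Prop :=
  M m /\ forall m', M m' -> mdivides m' m -> m' = m.

Definition mul_var (r : nat) (i : 'I_r) (J : 'X_{1..r}) : 'X_{1..r} :=
  [multinom (J k + (k == i))%N | k < r].

(* Main.v *)
(** For monomials of equal degree [< B], the weight [sum_i m_i B^i] reverses the
    reverse lexicographic order, so leading monomials are those of least weight.

    Strong stability of gin (Galligo). Let [X_k m] lead an element of an ideal [I] in
    general coordinates, and let [i < k]. If [X_i m] were not in in(I), then on [I] the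
    coefficients at [X_i m] and at the monomials of in(I) above it would be linearly
    dependent, and also on the image of [I] under the torus [X_j := s^(B^j) X_j] followed
    by the shear [X_k := X_k + X_i], which for almost all [s] has the same initial ideal.
    As [s -> 0], elements of [I] degenerate to their leading monomials, and on the shears
    of these monomials the coefficients form a triangular matrix; its diagonal entries
    are [1] and the exponent of [X_k] in [X_k m], nonzero in characteristic 0.

    Theorem. For [u] in in(I)_n choose [h_u] in [I_n] with leading monomial [u], divisible
    by [X_(max u)] when [u] is not a minimal generator. Since [I_(n+1) = S_1 I_n] is
    spanned by the [X_k h_u], and those with [k >= max u] have distinct leading monomials,
    none of them a minimal generator, it is enough to reduce the others to these modulo
    monomials below a minimal generator [P] of degree [n + 1]. When [u] is not a minimal
    generator this is the Eliahou-Kervaire exchange; otherwise [X_k h_u] already lies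
    below [P], unless [P] is below [X_k u] as claimed. *)

From HB Require Import structures.
Require Import Defs.
From mathcomp Require Import all_boot all_order all_algebra.
From mathcomp Require Import boolp complex Rstruct mpoly.

Set Implicit Arguments.
Unset Strict Implicit.
Unset Printing Implicit Defensive.

Import GRing.Theory.
Local Open Scope ring_scope.

(** * Reverse lexicographic weights *)

Definition revwt r B (m : 'X_{1..r}) : nat := (\sum_(i < r) m i * B ^ i)%N.

Lemma revwtD r B (a b : 'X_{1..r}) : revwt B (a + b)%MM = (revwt B a + revwt B b)%N.
Proof.
by rewrite /revwt -big_split; apply: eq_bigr => i _; rewrite mnmDE mulnDl.
Qed.

Lemma revwtU r B (k : 'I_r) : revwt B U_(k)%MM = (B ^ k)%N.
Proof.
rewrite /revwt (bigD1 k) //= mnm1E eqxx mul1n big1 ?addn0 // => i ne_ik.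
by rewrite mnm1E eq_sym (negbTE ne_ik).
Qed.

Lemma revwtMn r B (m : 'X_{1..r}) a : revwt B (m *+ a)%MM = (a * revwt B m)%N.
Proof.
by rewrite /revwt big_distrr; apply: eq_bigr => i _; rewrite mulmnE mulnAC mulnC.
Qed.

Lemma revwt_lower_part_lt r B (m : 'X_{1..r}) (k : 'I_r) : (mdeg m < B)%N ->
  (\sum_(i < r | (i < k)%N) m i * B ^ i < B ^ k)%N.
Proof.
move=> ltB; have B_gt0 : (0 < B)%N by apply: leq_ltn_trans ltB.
have leB : (B * \sum_(i < r | (i < k)%N) m i * B ^ i <= mdeg m * B ^ k)%N.
  rewrite mdegE big_distrl big_distrr /= [leqRHS](bigID (fun i : 'I_r => (i < k)%N)) /=.
  apply: leq_trans (leq_addr _ _); apply: leq_sum => i lt_ik.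
  by rewrite mulnCA -expnS leq_mul2l leq_pexp2l ?orbT.
rewrite -(ltn_pmul2l B_gt0); apply: leq_ltn_trans leB _.
by rewrite ltn_mul2r ltB expn_gt0 B_gt0.
Qed.

Lemma revwt_lt_last_diff r B (a b : 'X_{1..r}) (k : 'I_r) : (mdeg b < B)%N ->
    (b k < a k)%N -> (forall l : 'I_r, (k < l)%N -> a l = b l) ->
  (revwt B b < revwt B a)%N.
Proof.
move=> ltB lt_ba eq_above.
have split3 (m : 'X_{1..r}) :
    revwt B m = (\sum_(i < r | (i < k)%N) m i * B ^ i + m k * B ^ k
              + \sum_(i < r | (k < i)%N) m i * B ^ i)%N.
  rewrite /revwt (bigID (fun i : 'I_r => (i < k)%N)) /= -addnA; congr (_ + _)%N.
  rewrite (bigD1 k) /= ?ltnn //; congr (_ + _)%N; apply: eq_bigl => i.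
  by rewrite -leqNgt ltn_neqAle andbC -(inj_eq val_inj) eq_sym.
have eq_upper : (\sum_(i < r | (k < i)%N) a i * B ^ i
                 = \sum_(i < r | (k < i)%N) b i * B ^ i)%N.
  by apply: eq_bigr => i /eq_above ->.
rewrite !split3 eq_upper ltn_add2r; apply: (@leq_trans ((b k).+1 * B ^ k)).
  by rewrite mulSn ltn_add2r revwt_lower_part_lt.
by apply: leq_trans (leq_addl _ _); rewrite leq_mul2r lt_ba orbT.
Qed.

Lemma mnm_last_diff r (a b : 'X_{1..r}) : a != b ->
  exists k : 'I_r, a k != b k /\ forall l : 'I_r, (k < l)%N -> a l = b l.
Proof.
move=> ne_ab; have [k0 ne0] : exists k, a k != b k.
  apply/existsP; apply: contraNT ne_ab; rewrite negb_exists => /forallP eq_ab.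
  by apply/eqP/mnmP => i; apply/eqP; rewrite -[_ == _]negbK eq_ab.
case: (@arg_maxnP _ k0 (fun k => a k != b k) val ne0) => k ne_k max_k.
exists k; split=> // l; apply: contraTeq => /max_k.
by rewrite -leqNgt.
Qed.

Lemma revwt_inj r B (a b : 'X_{1..r}) :
  (mdeg a < B)%N -> (mdeg b < B)%N -> revwt B a = revwt B b -> a = b.
Proof.
move=> aB bB; apply: contra_eq => /mnm_last_diff [k [ne_k above]].
case: ltngtP ne_k => // lt_k _.
  by rewrite neq_ltn (revwt_lt_last_diff aB lt_k) // => l /above.
by rewrite neq_ltn (revwt_lt_last_diff bB lt_k) ?orbT // => l /above.
Qed.

Lemma revlex_ltP r B (a b : 'X_{1..r}) : mdeg a = mdeg b -> (mdeg b < B)%N ->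
  revlex_lt a b <-> (revwt B b < revwt B a)%N.
Proof.
move=> eq_deg bB; split=> [[|[_ [k [lt_k above]]]]|lt_wt].
- by rewrite eq_deg ltnn.
- exact: revwt_lt_last_diff above.
right; split=> //.
have /mnm_last_diff [k [ne_k above]] : a != b.
  by apply: contraTneq lt_wt => ->; rewrite ltnn.
exists k; split=> //; case: ltngtP ne_k => // lt_k _.
suff : (revwt B a < revwt B b)%N by rewrite ltnNge ltnW.
by apply: (revwt_lt_last_diff _ lt_k) => [|l /above //]; rewrite eq_deg.
Qed.

Definition revwt_ge {R : nzRingType} {r} B w : {pred {mpoly R[r]}} :=
  fun p => all (fun m => (w <= revwt B m)%N) (msupp p).

Section WeightFiltration.
Variables (R : nzRingType) (r B : nat).
Implicit Type p : {mpoly R[r]}.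

Lemma revwt_geP w p :
  reflect {in msupp p, forall m, (w <= revwt B m)%N} (p \in revwt_ge B w).
Proof. exact: allP. Qed.

Lemma revwt_geW v w p : (v <= w)%N -> p \in revwt_ge B w -> p \in revwt_ge B v.
Proof.
by move=> le_vw /revwt_geP ge_w; apply/revwt_geP => m /ge_w; apply: leq_trans.
Qed.

Fact revwt_ge_submod_closed w : submod_closed (@revwt_ge R r B w).
Proof.
split=> [|a p q /revwt_geP ge_p /revwt_geP ge_q]; apply/revwt_geP => m.
  by rewrite msupp0.
by move/msuppD_le; rewrite mem_cat => /orP[/msuppZ_le/ge_p|/ge_q].
Qed.

HB.instance Definition _ w :=
  GRing.isSubmodClosed.Build R {mpoly R[r]} (@revwt_ge R r B w)
    (revwt_ge_submod_closed w).

Lemma revwt_ge_mcoeff0 w p m : p \in revwt_ge B w -> (revwt B m < w)%N -> p@_m = 0.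
Proof.
move=> /revwt_geP ge_p lt_w; apply: memN_msupp_eq0; apply: contraTN lt_w => /ge_p.
by rewrite -leqNgt.
Qed.

End WeightFiltration.

Lemma mem_msuppXM r (R : comNzRingType) a m (p : {mpoly R[r]}) :
  m \in msupp ('X_[a] * p) -> exists2 m', m' \in msupp p & m = (a + m')%MM.
Proof. by rewrite mulrC (perm_mem (msuppMX _ _)) => /mapP. Qed.

Lemma revwt_geXM r (R : comNzRingType) B w a (p : {mpoly R[r]}) :
  p \in revwt_ge B w -> 'X_[a] * p \in revwt_ge B (revwt B a + w).
Proof.
move=> /revwt_geP ge_p; apply/revwt_geP => _ /mem_msuppXM [m /ge_p le_m ->].
by rewrite revwtD leq_add2l.
Qed.

Lemma dhomogXM r (R : comNzRingType) d a (p : {mpoly R[r]}) :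
  p \is d.-homog -> 'X_[a] * p \is (mdeg a + d).-homog.
Proof. by move=> hp; rewrite dhomogM // dhomogX. Qed.

(** * Leading monomials *)

Section LeadingMonomials.
Variables (r B d : nat).
Hypothesis ltdB : (d < B)%N.
Implicit Type p : {mpoly CC[r]}.

Lemma lead_monoP p (hp : p \is d.-homog) m :
  lead_mono p m <-> m \in msupp p /\ p \in revwt_ge B (revwt B m).
Proof.
move/dhomogP: hp => hp; split=> -[mp lead]; split=> //.
  apply/revwt_geP => m' m'p; have [-> //|/eqP ne] := eqVneq m' m.
  by apply/ltnW/revlex_ltP; rewrite ?hp //; apply: lead.
move=> m' m'p /eqP ne; apply/(@revlex_ltP _ B); rewrite ?hp // ltn_neqAle.
rewrite (revwt_geP _ _ _ lead) // andbT; apply: contra_neq ne => eq_wt.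
by apply/esym/(revwt_inj _ _ eq_wt); rewrite hp.
Qed.

Lemma lead_mono_exists p : p \is d.-homog -> p != 0 -> exists m, lead_mono p m.
Proof.
move=> hp nz_p; pose occurs w := has (fun m => revwt B m == w) (msupp p).
have ex_w : exists w, occurs w.
  by exists (revwt B (mlead p)); apply/hasP; exists (mlead p); rewrite ?mlead_supp.
case: (ex_minnP ex_w) => w /hasP [m mp /eqP <-] min_w.
exists m; apply/lead_monoP => //; split=> //; apply/revwt_geP => m' m'p.
by apply: min_w; apply/hasP; exists m'.
Qed.

Lemma cancel_lead_mono p q m : p \is d.-homog -> q \is d.-homog -> lead_mono q m ->
  p \in revwt_ge B (revwt B m) -> exists a, p - a *: q \in revwt_ge B (revwt B m).+1.
Proof.
move=> hp hq /(lead_monoP hq) [mq ge_q] ge_p; exists (p@_m / q@_m).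
have ge_pq : p - (p@_m / q@_m) *: q \in revwt_ge B (revwt B m).
  by rewrite rpredB // rpredZ.
have hpq : p - (p@_m / q@_m) *: q \is d.-homog by rewrite rpredB // rpredZ.
apply/revwt_geP => m' m'pq; rewrite ltn_neqAle (revwt_geP _ _ _ ge_pq) // andbT.
apply: contraTneq m'pq => /revwt_inj eq_m; rewrite mcoeff_msupp negbK.
have [hm' | /dhomog_nemf_coeff -> //] := eqVneq (mdeg m') d.
rewrite -eq_m ?(dhomog_mf hq mq) ?hm' //.
by rewrite mcoeffB mcoeffZ divfK ?subrr // -mcoeff_msupp.
Qed.

Lemma lead_mono_lin_comb (I : finType) (c : I -> CC) (F : I -> {mpoly CC[r]})
    (lead : I -> 'X_{1..r}) m (p := \sum_x c x *: F x) :
    {in [pred x | c x != 0] &, injective lead} ->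
    (forall x, c x != 0 -> F x \is d.-homog /\ lead_mono (F x) (lead x)) ->
    m \in msupp p -> p \in revwt_ge B (revwt B m) ->
  exists2 x, c x != 0 & m = lead x.
Proof.
move=> inj_lead leadF mp ge_p.
have ge_F x : c x != 0 -> F x \in revwt_ge B (revwt B (lead x)).
  by move=> /leadF [hF /(lead_monoP hF) []].
have deg_lead x : c x != 0 -> mdeg (lead x) = d.
  by move=> /leadF [hF [+ _]] => /(dhomog_mf hF).
have /existsP [x0 nz_x0] : [exists x, c x * (F x)@_m != 0].
  apply: contraTT mp; rewrite negb_exists mcoeff_msupp negbK => /forallP c0.
  by rewrite raddf_sum big1 //= => x _; rewrite mcoeffZ; apply/eqP/negbNE.
have /andP [nz_cx0 mFx0] : (c x0 != 0) && (m \in msupp (F x0)).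
  by rewrite mcoeff_msupp -negb_or -mulf_eq0.
case: (@arg_minnP _ x0 (fun x => c x != 0) (fun x => revwt B (lead x)) nz_cx0).
move=> x nz_cx min_x; exists x => //.
have nz_px : p@_(lead x) != 0.
  rewrite raddf_sum (bigD1 x) //= big1 => [|y ne_yx].
    rewrite addr0 mcoeffZ mulf_neq0 // -mcoeff_msupp.
    by have [_ []] := leadF x nz_cx.
  rewrite mcoeffZ; have [->|nz_cy] := eqVneq (c y) 0; first by rewrite mul0r.
  rewrite (revwt_ge_mcoeff0 (ge_F y nz_cy)) ?mulr0 // ltn_neqAle min_x // andbT.
  apply: contraNneq ne_yx => /revwt_inj eq_xy; apply/eqP/inj_lead => //.
  by apply/esym/eq_xy; rewrite deg_lead.
have deg_m : mdeg m = d by apply: dhomog_mf mFx0; have [] := leadF x0 nz_cx0.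
apply: (@revwt_inj _ B); rewrite ?deg_m ?deg_lead //.
apply/eqP; rewrite eqn_leq (revwt_geP _ _ _ ge_p) ?mcoeff_msupp //=.
exact: leq_trans (min_x _ nz_cx0) (revwt_geP _ _ _ (ge_F _ nz_cx0) _ mFx0).
Qed.

End LeadingMonomials.

(** * Homogeneous ideals *)

Lemma mcoeff_pihomog r (R : comNzRingType) (p : {mpoly R[r]}) m :
  (pihomog mdeg (mdeg m) p)@_m = p@_m.
Proof.
rewrite pihomogE [RHS](congr1 (mcoeff m) (mpolyE p)).
rewrite [in RHS](bigID (fun u => mdeg u == mdeg m)) /=.
rewrite mcoeffD [X in _ + X]raddf_sum [X in _ + X]big1 ?addr0 //= => u ne_deg.
by rewrite mcoeffZ mcoeffX; case: (u =P m) ne_deg => [->|_ _]; rewrite ?eqxx ?mulr0.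
Qed.

Lemma pihomogMr r (R : comNzRingType) d e (p q : {mpoly R[r]}) :
  q \is e.-homog ->
  pihomog mdeg d (p * q) = if (e <= d)%N then pihomog mdeg (d - e) p * q else 0.
Proof.
move=> hq; pose k := maxn (msize p) d.+1.
have pihomog_part j : pihomog mdeg d (pihomog mdeg j p * q)
    = if (j + e == d)%N then pihomog mdeg j p * q else 0.
  have hj : pihomog mdeg j p * q \is (j + e).-homog by rewrite dhomogM ?pihomogP.
  have [<-|ne_d] := eqVneq; first by rewrite pihomog_dE.
  by rewrite (pihomog_ne0 ne_d).
rewrite {1}(pihomog_partitionE (leq_maxl (msize p) d.+1)) mulr_suml raddf_sum /=.
under eq_bigr do rewrite pihomog_part.
case: leqP => [le_ed|lt_de]; last first.
  by rewrite big1 // => j _; rewrite gtn_eqF // ltn_addl.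
have lt_k : (d - e < k)%N by rewrite leq_max ltnS leq_subr orbT.
rewrite (bigD1 (Ordinal lt_k)) //= subnK // eqxx big1 ?addr0 // => j.
by rewrite -val_eqE /= -(eqn_add2r e) subnK // => /negbTE ->.
Qed.

Lemma dhomogS_split r (R : comNzRingType) d (p : {mpoly R[r]}) : p \is d.+1.-homog ->
  exists q : 'I_r -> {mpoly R[r]},
    p = \sum_i 'X_i * q i /\ forall i, q i \is d.-homog.
Proof.
move=> hp; pose var (m : 'X_{1..r}) := [pick i | m i != 0%N].
exists (fun i => \sum_(m <- msupp p | var m == Some i) p@_m *: 'X_[m - U_(i)]); split.
  under eq_bigr do rewrite mulr_sumr.
  rewrite (exchange_big_dep predT) //= {1}[p]mpolyE !big_seq.
  apply: eq_bigr => m /(dhomog_mf hp) deg_m; rewrite /var; case: pickP => [i nz_mi|m0].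
    rewrite (big_pred1 i) => [|j]; last by rewrite eq_sym.
    by rewrite -scalerAr -mpolyXD addmC submK // lep1mP.
  move: deg_m; rewrite /= mdegE big1 // => i _; exact/eqP/negbFE/m0.
move=> i; rewrite big_seq_cond; apply: rpred_sum => m /andP [/(dhomog_mf hp)].
rewrite /var; case: pickP => // j + deg_m /eqP [eq_ji].
rewrite eq_ji -lep1mP => le_m; rewrite rpredZ // dhomogX /= -eqSS -deg_m.
by rewrite -{2}(submK le_m) /= mdegD mdeg1 addn1.
Qed.

Lemma homogeneous_ofP r d (p : {mpoly CC[r]}) :
  homogeneous_of d p <-> p \is d.-homog.
Proof. by split=> [h|/dhomogP //]; apply/dhomogP. Qed.

Definition homog_gens r (gs : seq {mpoly CC[r]}) : Prop :=
  {in gs, forall g, g \is homog mdeg}.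

Definition homog_gens_le r n (gs : seq {mpoly CC[r]}) : Prop :=
  {in gs, forall g, exists2 d, (d <= n)%N & g \is d.-homog}.

Lemma homog_gens_leW r n (gs : seq {mpoly CC[r]}) : homog_gens_le n gs -> homog_gens gs.
Proof. by move=> hgs g /hgs [d _]; apply: homogE. Qed.

Lemma homog_gens_leP r n (gs : seq {mpoly CC[r]}) :
  homog_gens_le n gs <->
  forall p, p \in gs -> exists d, (d <= n)%N /\ homogeneous_of d p.
Proof.
split=> hgs g /hgs [d]; first by move=> le_dn /homogeneous_ofP; exists d.
by case=> le_dn /homogeneous_ofP; exists d.
Qed.

Section Ideals.
Variables (r : nat) (gs : seq {mpoly CC[r]}).
Implicit Types p q : {mpoly CC[r]}.

Lemma in_idealP p :
  in_ideal gs p <->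
  exists c : nat -> {mpoly CC[r]}, p = \sum_(k < size gs) c k * gs`_k.
Proof.
split=> [[cs ->]|[c ->]]; first by exists (nth 0 cs).
exists (mkseq c (size gs)); apply: eq_bigr => k _.
by rewrite nth_mkseq.
Qed.

Lemma in_ideal0 : in_ideal gs 0.
Proof. by apply/in_idealP; exists (fun=> 0); rewrite big1 // => k; rewrite mul0r. Qed.

Lemma in_idealD p q : in_ideal gs p -> in_ideal gs q -> in_ideal gs (p + q).
Proof.
move=> /in_idealP [c ->] /in_idealP [c' ->]; apply/in_idealP.
exists (fun k => c k + c' k); rewrite -big_split.
by apply: eq_bigr => k _; rewrite mulrDl.
Qed.

Lemma in_idealM p q : in_ideal gs q -> in_ideal gs (p * q).
Proof.
move=> /in_idealP [c ->]; apply/in_idealP; exists (fun k => p * c k).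
by rewrite mulr_sumr; apply: eq_bigr => k _; rewrite mulrA.
Qed.

Lemma in_idealZ a p : in_ideal gs p -> in_ideal gs (a *: p).
Proof. by rewrite -mul_mpolyC; apply: in_idealM. Qed.

Lemma in_idealB p q : in_ideal gs p -> in_ideal gs q -> in_ideal gs (p - q).
Proof. by move=> Ip Iq; rewrite -scaleN1r; apply/in_idealD/in_idealZ. Qed.

Lemma in_ideal_sum (I : finType) (F : I -> {mpoly CC[r]}) :
  (forall i, in_ideal gs (F i)) -> in_ideal gs (\sum_i F i).
Proof. by move=> h; apply: big_ind => //; [apply: in_ideal0|apply: in_idealD]. Qed.

Lemma in_ideal_pihomogP d p : homog_gens gs -> in_ideal gs p ->
  exists c : nat -> {mpoly CC[r]},
    pihomog mdeg d p = \sum_(k < size gs) c k * gs`_k /\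
    forall k, c k \is (d - (msize gs`_k).-1).-homog.
Proof.
move=> hgs /in_idealP [c ->]; pose e k := (msize gs`_k).-1.
exists (fun k => if (e k <= d)%N then pihomog mdeg (d - e k) (c k) else 0).
split=> [|k]; last by case: ifP; rewrite ?pihomogP ?dhomog0.
rewrite raddf_sum; apply: eq_bigr => k _ /=.
have hk : gs`_k \is (e k).-homog by rewrite -homog_msize hgs ?mem_nth.
by rewrite (pihomogMr _ _ hk); case: ifP; rewrite ?mul0r.
Qed.

Lemma in_ideal_succ n p : homog_gens_le n gs -> in_ideal gs p -> p \is n.+1.-homog ->
  exists q : 'I_r -> {mpoly CC[r]},
    p = \sum_i 'X_i * q i /\ forall i, in_ideal gs (q i) /\ q i \is n.-homog.
Proof.
move=> hgs Ip hp; have hom := homog_gens_leW hgs.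
have [c [pE hc]] := in_ideal_pihomogP n.+1 hom Ip; rewrite pihomog_dE // in pE.
pose e k := (msize gs`_k).-1.
have le_en k : (e k <= n)%N.
  rewrite /e; case: (ltnP k (size gs)) => [/(mem_nth 0)/hgs [d le_dn hk]|le_k].
    have [->|nz_k] := eqVneq gs`_k 0; first by rewrite msize0.
    by rewrite (dhomog_uniq nz_k (dhomog_msize hk) hk).
  by rewrite nth_default // msize0.
have /choice [q qP] k : exists q : 'I_r -> {mpoly CC[r]},
    c k = \sum_i 'X_i * q i /\ forall i, q i \is (n - e k).-homog.
  by apply: dhomogS_split; rewrite -subSn // hc.
exists (fun i => \sum_(k < size gs) q k i * gs`_k); split.
  rewrite pE; under [RHS]eq_bigr do rewrite mulr_sumr; rewrite exchange_big.
  apply: eq_bigr => k _; rewrite (qP k).1 mulr_suml.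
  by apply: eq_bigr => i _; rewrite mulrA.
move=> i; split; first by apply/in_idealP; exists (q^~ i).
apply: rpred_sum => k _; rewrite -(subnK (le_en k)) dhomogM ?(qP k).2 //.
by rewrite -homog_msize hom ?mem_nth.
Qed.

(** * Initial ideals *)

Definition initial_lift m p : Prop :=
  [/\ in_ideal gs p, p \is (mdeg m).-homog & lead_mono p m].

Lemma in_initial_lift m :
  homog_gens gs -> in_initial gs m -> exists p, initial_lift m p.
Proof.
move=> hgs [p [Ip [mp lead]]]; exists (pihomog mdeg (mdeg m) p).
have hpi := pihomogP mdeg (mdeg m) p; split=> //.
  by have [c [-> _]] := in_ideal_pihomogP (mdeg m) hgs Ip; apply/in_idealP; exists c.
split=> [|m' m'p]; first by rewrite mcoeff_msupp mcoeff_pihomog -mcoeff_msupp.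
apply: lead; have /= deg_m' := dhomog_mf hpi m'p.
by move: m'p; rewrite -deg_m' !mcoeff_msupp mcoeff_pihomog.
Qed.

Lemma initial_liftXM a m p :
  initial_lift m p -> initial_lift (a + m) ('X_[a] * p).
Proof.
move=> [Ip hp]; pose d := mdeg (a + m).
have lt_md : (mdeg m < d.+1)%N by rewrite ltnS /d mdegD leq_addl.
have hXp : 'X_[a] * p \is d.-homog by rewrite /d mdegD dhomogXM.
move/(lead_monoP lt_md hp) => [mp ge_p]; split=> //; first exact: in_idealM.
apply/(lead_monoP (ltnSn d) hXp); rewrite revwtD revwt_geXM //; split=> //.
by rewrite mcoeff_msupp mulrC mcoeffMX -mcoeff_msupp.
Qed.

Lemma in_initialXM a m :
  homog_gens gs -> in_initial gs m -> in_initial gs (a + m).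
Proof.
move=> hgs /(in_initial_lift hgs) [p /(initial_liftXM a) [IXp _ lead]].
by exists ('X_[a] * p).
Qed.

End Ideals.

(** * Strongly stable monomial ideals *)

Definition strongly_stable r (M : 'X_{1..r} -> Prop) : Prop :=
  forall (i k : 'I_r) m, (i < k)%N -> M (U_(k) + m)%MM -> M (U_(i) + m)%MM.

Definition mnm_max_le r (m : 'X_{1..r}) (k : 'I_r) : bool :=
  [forall l : 'I_r, (k < l)%N ==> (m l == 0%N)].

Lemma mnm_max_leP r (m : 'X_{1..r}) (k : 'I_r) :
  reflect (forall l : 'I_r, (k < l)%N -> m l = 0%N) (mnm_max_le m k).
Proof.
apply: (iffP forallP) => [max_m l lt_kl|max_m l]; first exact/eqP/(implyP (max_m l)).
by apply/implyP => /max_m ->.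
Qed.

Lemma mnm_max_lePn r (m : 'X_{1..r}) (k : 'I_r) :
  reflect (exists2 l : 'I_r, (k < l)%N & (0 < m l)%N) (~~ mnm_max_le m k).
Proof.
rewrite negb_forall; apply: (iffP existsP) => [[l]|[l lt_kl ml]]; last first.
  by exists l; rewrite negb_imply lt_kl -lt0n.
by rewrite negb_imply -lt0n => /andP[]; exists l.
Qed.

Lemma mnm_max_leW r (m : 'X_{1..r}) (k l : 'I_r) :
  (k <= l)%N -> mnm_max_le m k -> mnm_max_le m l.
Proof.
move=> le_kl /mnm_max_leP max_m; apply/mnm_max_leP => j lt_lj.
by rewrite max_m // (leq_ltn_trans le_kl).
Qed.

Lemma mnm_max_le_addU r (m : 'X_{1..r}) (i k : 'I_r) :
  mnm_max_le (U_(i) + m)%MM k = (i <= k)%N && mnm_max_le m k.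
Proof.
apply/mnm_max_leP/andP => [max_im|[le_ik /mnm_max_leP max_m] l lt_kl]; last first.
  by rewrite mnmDE mnm1E max_m // -val_eqE ltn_eqF ?(leq_ltn_trans le_ik).
split; last first.
  by apply/mnm_max_leP => l /max_im /eqP; rewrite mnmDE addn_eq0 => /andP[_ /eqP].
by rewrite leqNgt; apply/negP => /max_im; rewrite mnmDE mnm1E eqxx.
Qed.

Lemma mnm_max_le_inj r (u v : 'X_{1..r}) (i k : 'I_r) :
  mnm_max_le u i -> mnm_max_le v k ->
  (U_(i) + u = U_(k) + v)%MM -> (u, i) = (v, k).
Proof.
move=> max_u max_v eq_uv; suff eq_ik : i = k.
  by move: eq_uv; rewrite eq_ik => /addmI ->.
have le_ik : (i <= k)%N.
  have : mnm_max_le (U_(k) + v)%MM k by rewrite mnm_max_le_addU leqnn.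
  by rewrite -eq_uv mnm_max_le_addU => /andP[].
have le_ki : (k <= i)%N.
  have : mnm_max_le (U_(i) + u)%MM i by rewrite mnm_max_le_addU leqnn.
  by rewrite eq_uv mnm_max_le_addU => /andP[].
by apply/val_inj/anti_leq; rewrite le_ik.
Qed.

Lemma mnm_max_split r (m : 'X_{1..r}) : m != 0%MM ->
  exists k v, m = (U_(k) + v)%MM /\ mnm_max_le m k.
Proof.
move=> /mnm_last_diff [k [nz_k above]]; rewrite mnm0E in nz_k.
exists k, (m - U_(k))%MM; split; first by rewrite addmC submK // lep1mP.
by apply/mnm_max_leP => l /above ->; rewrite mnm0E.
Qed.

Lemma min_gen_addU r (M : 'X_{1..r} -> Prop) i m : min_gen M (U_(i) + m)%MM -> ~ M m.
Proof.
move=> [_ min_m] Mm; have /(congr1 (@mdeg r))/eqP : m = (U_(i) + m)%MM.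
  by apply: min_m => // l; rewrite mnmDE leq_addl.
by rewrite mdegD mdeg1 -[eqbLHS]add0n eqn_add2r.
Qed.

Section MonomialIdeals.
Variables (r : nat) (M : 'X_{1..r} -> Prop).
Hypothesis M_ideal : forall a m, M m -> M (a + m)%MM.

Lemma not_min_gen_split m : M m -> ~ min_gen M m ->
  exists i v, m = (U_(i) + v)%MM /\ M v.
Proof.
move=> Mm nmin; have [m' [Mm' dvd_m' /eqP ne_m']] :
    exists m', [/\ M m', mdivides m' m & m' <> m].
  apply: contrapT => no; apply: nmin; split=> // m' Mm' dvd_m'.
  apply: contrapT => ne_m'.
  by apply: no; exists m'.
have mE : m = ((m - m') + m')%MM by rewrite submK //; apply/mnm_lepP.
have : (m - m')%MM != 0%MM by apply: contraNneq ne_m' => m'0; rewrite mE m'0 add0m.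
move=> /mnm_max_split [i [v [vE _]]]; exists i, (v + m')%MM.
by rewrite addmA -vE -mE; split=> //; apply: M_ideal.
Qed.

Lemma strongly_stable_max_split m : strongly_stable M -> M m -> ~ min_gen M m ->
  exists k v, [/\ m = (U_(k) + v)%MM, M v & mnm_max_le m k].
Proof.
move=> stM Mm /(not_min_gen_split Mm) [i [v [mE Mv]]].
have [|k [w [mE' max_m]]] := @mnm_max_split _ m.
  by rewrite mE mnmD_eq0 mnm1_eq0.
have [eq_ik|ne_ik] := eqVneq i k.
  by exists k, v; rewrite -eq_ik -mE; split=> //; rewrite eq_ik.
have lt_ik : (i < k)%N.
  by move: max_m; rewrite mE mnm_max_le_addU ltn_neqAle ne_ik => /andP[].
have vk : (U_(k) <= v)%MM.
  have : (0 < m k)%N by rewrite mE' mnmDE mnm1E eqxx.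
  by rewrite mE mnmDE mnm1E (negbTE ne_ik) lep1mP lt0n.
have vE : v = (U_(k) + (v - U_(k)))%MM by rewrite addmC submK.
exists k, (U_(i) + (v - U_(k)))%MM; split=> //.
  by rewrite mE {1}vE !addmA [(U_(i) + _)%MM]addmC.
by apply: (stM i k) => //; rewrite -vE.
Qed.

End MonomialIdeals.

Definition stable_lift r (gs : seq {mpoly CC[r]}) u p : Prop :=
  initial_lift gs u p /\
  (min_gen (in_initial gs) u \/
   exists k v q, [/\ p = 'X_k * q, u = (U_(k) + v)%MM, initial_lift gs v q
                   & mnm_max_le u k]).

Lemma stable_lift_exists r (gs : seq {mpoly CC[r]}) u :
    homog_gens gs -> strongly_stable (in_initial gs) ->
  in_initial gs u -> exists p, stable_lift gs u p.
Proof.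
move=> hgs stM Mu; have [min_u|nmin_u] := pselect (min_gen (in_initial gs) u).
  by have [p lift_p] := in_initial_lift hgs Mu; exists p; split=> //; left.
have idealM a m : in_initial gs m -> in_initial gs (a + m) by apply: in_initialXM.
have [k [v [uE Mv max_u]]] := strongly_stable_max_split idealM stM Mu nmin_u.
have [q lift_q] := in_initial_lift hgs Mv; exists ('X_k * q).
split; first by rewrite uE; apply: initial_liftXM.
by right; exists k, v, q.
Qed.

(** * Reduction to multiplicative products *)

Section MultiplicativeReduction.
Variables (r n w : nat) (gs : seq {mpoly CC[r]}) (h : 'X_{1..r} -> {mpoly CC[r]}).
Implicit Types (p q : {mpoly CC[r]}) (u v : 'X_{1..r}) (k : 'I_r).

Hypothesis h_lift : forall u, in_initial gs u -> mdeg u = n -> stable_lift gs u (h u).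

Let B := n.+2.
Let lt_nB : (n < B)%N. Proof. exact: leqW. Qed.

(* The multiplicative variables of Pommaret bases. *)
Definition multiplicative u k : Prop :=
  [/\ in_initial gs u, mdeg u = n & mnm_max_le u k].

Definition reduced p : Prop :=
  exists c : 'X_{1..r < n.+1} * 'I_r -> CC,
    (forall x, c x != 0 -> multiplicative x.1 x.2) /\
    p - \sum_x c x *: ('X_(x.2) * h x.1) \in revwt_ge B w.

Lemma reduced_revwt_ge p : p \in revwt_ge B w -> reduced p.
Proof.
move=> ge_p; exists (fun=> 0); split=> [x|]; first by rewrite eqxx.
by rewrite big1 ?subr0 // => x _; rewrite scale0r.
Qed.

Lemma reducedD p q : reduced p -> reduced q -> reduced (p + q).
Proof.
move=> [a [mult_a red_a]] [b [mult_b red_b]]; exists (fun x => a x + b x); split=> [x|].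
  by have [->|/mult_a //] := eqVneq (a x) 0; rewrite add0r => /mult_b.
under eq_bigr do rewrite scalerDl.
by rewrite big_split opprD addrACA rpredD.
Qed.

Lemma reducedZ a p : reduced p -> reduced (a *: p).
Proof.
move=> [c [mult_c red_c]]; exists (fun x => a * c x); split=> [x|].
  by rewrite mulf_eq0 negb_or => /andP[_ /mult_c].
under eq_bigr do rewrite -scalerA.
by rewrite -scaler_sumr -scalerBr rpredZ.
Qed.

Lemma reduced_multiplicative u k : multiplicative u k -> reduced ('X_k * h u).
Proof.
move=> mult_u; have lt_u : (mdeg u < n.+1)%N by case: mult_u => _ ->.
pose x0 : 'X_{1..r < n.+1} * 'I_r := (BMultinom lt_u, k).
exists (fun x => (x == x0)%:R); split=> [x|].
  by have [->|] := eqVneq x x0; rewrite ?eqxx.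
rewrite (bigD1 x0) //= eqxx scale1r big1 => [|x /negbTE ->]; last by rewrite scale0r.
by rewrite addr0 subrr rpred0.
Qed.

Lemma reduced_lead_mono p m : reduced p -> p \is n.+1.-homog -> lead_mono p m ->
  (revwt B m < w)%N -> exists k u, in_initial gs u /\ m = (U_(k) + u)%MM.
Proof.
move=> [c [mult_c ge_e]] hp /(lead_monoP (ltnSn _) hp) [mp ge_p] lt_w.
pose F (x : 'X_{1..r < n.+1} * 'I_r) := 'X_(x.2) * h x.1.
have lead_F x : c x != 0 ->
    F x \is n.+1.-homog /\ lead_mono (F x) (U_(x.2) + x.1)%MM.
  move=> /mult_c [Mx deg_x _]; have [lift_x _] := h_lift Mx deg_x.
  have [_ + lead_x] := initial_liftXM U_(x.2) lift_x.
  by rewrite mdegD mdeg1 deg_x.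
have ge_F : \sum_x c x *: F x \in revwt_ge B (revwt B m).
  by rewrite -(rpredBl _ ge_p) (revwt_geW (ltnW lt_w)).
have mF : m \in msupp (\sum_x c x *: F x).
  move: mp; rewrite !mcoeff_msupp; have := revwt_ge_mcoeff0 ge_e lt_w.
  by rewrite mcoeffB => /eqP; rewrite subr_eq0 => /eqP ->.
have [|x /mult_c [Mx _ _] ->] := lead_mono_lin_comb (ltnSn n.+1) _ lead_F mF ge_F.
  move=> [[u lt_u] k] [[v lt_v] l] /mult_c [_ _ max_u] /mult_c [_ _ max_v] /=.
  by move=> /(mnm_max_le_inj max_u max_v) [eq_uv ->]; congr (_, _); apply: val_inj.
by exists x.2, x.1.
Qed.

Hypothesis syzygy_ge : forall u k, min_gen (in_initial gs) u -> mdeg u = n ->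
  ~~ mnm_max_le u k -> (w <= revwt B (U_(k) + u))%N.

Definition reducible_above t : Prop := forall q k,
  in_ideal gs q -> q \is n.-homog -> 'X_k * q \in revwt_ge B t -> reduced ('X_k * q).

Lemma reduced_cancel t q u k : reducible_above t.+1 ->
    in_ideal gs q -> q \is n.-homog -> in_initial gs u -> mdeg u = n ->
    q \in revwt_ge B (revwt B u) -> (t <= revwt B (U_(k) + u))%N ->
  reduced ('X_k * h u) -> reduced ('X_k * q).
Proof.
move=> red_t Iq hq Mu deg_u ge_q le_t red_u.
have [[Ih hh lead_h] _] := h_lift Mu deg_u; rewrite deg_u in hh.
have [a ge_qh] := cancel_lead_mono lt_nB hq hh lead_h ge_q.
rewrite -(subrK (a *: h u) q) mulrDr -scalerAr; apply: reducedD; last exact: reducedZ.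
apply: red_t; first by apply/in_idealB/in_idealZ.
  by rewrite rpredB // rpredZ.
by apply: revwt_geW (revwt_geXM _ ge_qh); rewrite addnS -revwtD.
Qed.

(* Eliahou-Kervaire: if [X_k] is not multiplicative for [u = X_l u'], where [l] is the
   maximal index of [u] and [h u = X_l q], then [X_k h_u = X_l (X_k q)], where [X_l] is
   multiplicative for [X_k u']. *)
Lemma reduced_lift t u k : reducible_above t.+1 ->
    in_initial gs u -> mdeg u = n -> (t <= revwt B (U_(k) + u))%N ->
  reduced ('X_k * h u).
Proof.
move=> red_t Mu deg_u le_t; have [max_u|nmax_u] := boolP (mnm_max_le u k).
  exact: reduced_multiplicative.
have [[Ih hh lead_h] [min_u|]] := h_lift Mu deg_u; rewrite deg_u in hh.
  have [_ /(revwt_geXM U_(k)) ge_h] := (lead_monoP lt_nB hh _).1 lead_h.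
  apply/reduced_revwt_ge/(revwt_geW _ ge_h).
  by rewrite -revwtD syzygy_ge.
move=> [l [u' [q [-> uE lift_q max_u]]]]; rewrite mulrCA.
have [IXq hXq lead_Xq] := initial_liftXM U_(k) lift_q.
have deg_ku' : mdeg (U_(k) + u')%MM = n by rewrite -deg_u uE !mdegD !mdeg1.
rewrite deg_ku' in hXq; have [_ ge_Xq] := (lead_monoP lt_nB hXq _).1 lead_Xq.
have Mku' : in_initial gs (U_(k) + u')%MM by exists ('X_k * q).
apply: (reduced_cancel red_t IXq hXq Mku') => //.
  by rewrite addmA [(U_(l) + _)%MM]addmC -addmA -uE.
apply: reduced_multiplicative; split=> //.
have max_u' : mnm_max_le u' l by move: max_u; rewrite uE mnm_max_le_addU => /andP[].
rewrite mnm_max_le_addU max_u' andbT leqNgt; apply: contra nmax_u => lt_lk.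
exact: mnm_max_leW (ltnW lt_lk) max_u.
Qed.

Lemma reducible_above_pred t : reducible_above t.+1 -> reducible_above t.
Proof.
move=> red_t q k Iq hq ge_Xq.
have [->|nz_q] := eqVneq q 0.
  by rewrite mulr0; apply/reduced_revwt_ge/rpred0.
have [u lead_u] := lead_mono_exists lt_nB hq nz_q.
have Mu : in_initial gs u by exists q.
have [uq ge_q] := (lead_monoP lt_nB hq _).1 lead_u.
have deg_u : mdeg u = n := dhomog_mf hq uq.
have le_t : (t <= revwt B (U_(k) + u))%N.
  apply: (revwt_geP _ _ _ ge_Xq).
  by rewrite mcoeff_msupp mulrC mcoeffMX -mcoeff_msupp.
exact: reduced_cancel red_t Iq hq Mu deg_u ge_q le_t (reduced_lift red_t Mu deg_u le_t).
Qed.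

Lemma reducedXM q k : in_ideal gs q -> q \is n.-homog -> reduced ('X_k * q).
Proof.
move=> Iq hq; have red t : reducible_above (w - t).
  elim: t => [|t red_t]; first by rewrite subn0 => p l _ _; apply: reduced_revwt_ge.
  by rewrite subnS; case: (w - t)%N red_t => [//|j]; apply: reducible_above_pred.
by apply: (red w) => //; rewrite subnn; apply/revwt_geP.
Qed.

End MultiplicativeReduction.

Lemma min_gen_below_syzygy r n (gs : seq {mpoly CC[r]}) m :
    homog_gens_le n gs -> strongly_stable (in_initial gs) ->
    min_gen (in_initial gs) m -> mdeg m = n.+1 ->
  exists u i, [/\ min_gen (in_initial gs) u, mdeg u = n, ~~ mnm_max_le u i
                & revlex_lt m (U_(i) + u)].
Proof.
move=> hgs stM min_m deg_m; apply: contrapT => no_syzygy.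
have hom := homog_gens_leW hgs.
have syzygy_ge u k : min_gen (in_initial gs) u -> mdeg u = n -> ~~ mnm_max_le u k ->
    ((revwt n.+2 m).+1 <= revwt n.+2 (U_(k) + u))%N.
  move=> min_u deg_u nmax_u; have deg_ku : mdeg (U_(k) + u)%MM = n.+1.
    by rewrite mdegD mdeg1 deg_u.
  rewrite ltnNge leq_eqVlt; apply/negP => /orP[/eqP /revwt_inj eq_m|lt_m].
    by move: min_m; rewrite -eq_m ?deg_m ?deg_ku // => /min_gen_addU []; case: min_u.
  apply: no_syzygy; exists u, k; split=> //.
  by apply/(@revlex_ltP _ n.+2); rewrite ?deg_m ?deg_ku.
have /choice [h h_lift] u :
    exists p, in_initial gs u -> mdeg u = n -> stable_lift gs u p.
  have [Mu|nMu] := pselect (in_initial gs u); last by exists 0.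
  by have [p lift_p] := stable_lift_exists hom stM Mu; exists p.
have [p [Ip hp lead_p]] := in_initial_lift hom min_m.1; rewrite deg_m in hp.
have [q [pE hq]] := in_ideal_succ hgs Ip hp.
have red_p : reduced n (revwt n.+2 m).+1 gs h p.
  rewrite pE; apply: big_ind => [||i _]; first exact/reduced_revwt_ge/rpred0.
    exact: reducedD.
  by have [Iqi hqi] := hq i; apply: reducedXM.
have [k [u [Mu mE]]] := reduced_lead_mono h_lift red_p hp lead_p (ltnSn _).
by move: min_m; rewrite mE => /min_gen_addU.
Qed.

(** * Generic matrices *)

Lemma char0_poly_nonroot (R : idomainType) (p : {poly R}) :
  [pchar R] =i pred0 -> p != 0 -> exists s, p.[s] != 0.
Proof.
move=> /pcharf0P charR0 nz_p; pose rs := [seq n%:R : R | n <- iota 0 (size p)].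
have natr_inj : injective (fun n => n%:R : R).
  have le_inj a b : (a <= b)%N -> a%:R = b%:R :> R -> a = b.
    move=> le_ab /eqP; rewrite eq_sym -subr_eq0 -natrB // charR0 subn_eq0.
    by move=> le_ba; apply/eqP; rewrite eqn_leq le_ab.
  move=> a b eq_ab; case/orP: (leq_total a b) => le_ab; first exact: le_inj.
  by apply/esym/le_inj.
have /allPn [s _ nroot] : ~~ all (root p) rs.
  apply/negP => /(max_poly_roots nz_p); rewrite map_inj_uniq ?iota_uniq //.
  by rewrite size_map size_iota ltnn => /(_ isT).
by exists s.
Qed.

(* Kronecker substitution [X_i := s ^ (B ^ i)]. *)
Lemma char0_mpoly_nonroot (R : idomainType) r (f : {mpoly R[r]}) :
  [pchar R] =i pred0 -> f != 0 -> exists v, f.@[v] != 0.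
Proof.
move=> charR0 nz_f; pose B := msize f.
pose F : {poly R} := \sum_(m <- msupp f) f@_m *: 'X^(revwt B m).
have nz_F : F != 0.
  apply/eqP => /(congr1 (fun p : {poly R} => p`_(revwt B (mlead f)))).
  rewrite coef0 coef_sum (bigD1_seq (mlead f)) ?mlead_supp ?msupp_uniq //=.
  rewrite big_seq_cond big1 => [|m /andP[mf ne_m]].
    rewrite coefZ coefXn eqxx mulr1 addr0 => /eqP.
    by rewrite mleadc_eq0 (negbTE nz_f).
  rewrite coefZ coefXn; case: eqP => [eq_wt|_]; last by rewrite mulr0.
  case/eqP: ne_m; apply/esym/(revwt_inj _ _ eq_wt); apply: msize_mdeg_lt => //.
  exact: mlead_supp.
have [s Fs] := char0_poly_nonroot charR0 nz_F; exists (fun i => s ^+ (B ^ i)).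
suff -> : f.@[fun i => s ^+ (B ^ i)] = F.[s] by [].
rewrite mevalE horner_sum; apply: eq_bigr => m _.
rewrite hornerZ hornerXn expr_sum; congr (_ * _).
by apply: eq_bigr => i _; rewrite -exprM mulnC.
Qed.

Definition mxeval {K : fieldType} {r} (f : {mpoly K[r * r]}) (g : 'M[K]_r) : K :=
  f.@[fun k => mxvec g 0 k].

Definition generically {K : fieldType} {r} (U : 'M[K]_r -> Prop) : Prop :=
  exists f : {mpoly K[r * r]},
    f != 0 /\ forall g : 'M[K]_r, g \in unitmx -> mxeval f g != 0 -> U g.

Section Generic.
Variables (K : fieldType) (r : nat).
Hypothesis charK0 : [pchar K] =i pred0.
Implicit Types (f : {mpoly K[r * r]}) (g a : 'M[K]_r) (U V : 'M[K]_r -> Prop).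

Lemma mxeval_nonroot f : f != 0 -> exists g, mxeval f g != 0.
Proof.
move=> /(char0_mpoly_nonroot charK0) [v nz_fv]; exists (vec_mx (\row_k v k)).
by rewrite /mxeval vec_mxK (meval_eq _ (fun k => mxE _ _ 0 k)).
Qed.

Let generic_mx : 'M[{mpoly K[r * r]}]_r := \matrix_(i, j) 'X_(mxvec_index i j).

Let map_generic_mx g : map_mx (meval (fun k => mxvec g 0 k)) generic_mx = g.
Proof. by apply/matrixP => i j; rewrite !mxE mevalXU mxvecE. Qed.

Lemma mxeval_det : exists f, mxeval f =1 determinant.
Proof.
by exists (\det generic_mx) => g; rewrite /mxeval -det_map_mx map_generic_mx.
Qed.

Lemma mxeval_mulmxr a f : exists fa, forall g, mxeval fa g = mxeval f (g *m a).
Proof.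
pose ga := mxvec (generic_mx *m map_mx (@mpolyC _ K) a).
exists (f \mPo [tuple ga 0 k | k < r * r]) => g.
rewrite /mxeval comp_mpoly_meval; apply: meval_eq => k; rewrite tnth_mktuple.
transitivity (map_mx (meval (fun k => mxvec g 0 k)) ga 0 k); first by rewrite mxE.
rewrite /ga map_mxvec map_mxM map_generic_mx -map_mx_comp; congr ((mxvec (_ *m _)) 0 k).
by apply/matrixP => i j; rewrite mxE; apply: mevalC.
Qed.

Lemma mxeval_curve (A : 'M[{poly K}]_r) f :
  exists F : {poly K}, forall s, F.[s] = mxeval f (map_mx (horner_eval s) A).
Proof.
exists (\sum_(m <- msupp f) f@_m *: \prod_k (mxvec A 0 k) ^+ m k) => s.
rewrite /mxeval mevalE horner_sum; apply: eq_bigr => m _.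
rewrite hornerZ horner_prod; congr (_ * _); apply: eq_bigr => k _.
by rewrite horner_exp -map_mxvec mxE.
Qed.

Lemma generically_exists U : generically U -> exists2 g, g \in unitmx & U g.
Proof.
move=> [f [nz_f Uf]]; have [D DE] := mxeval_det.
have nz_D : D != 0.
  by apply: contra_eq_neq (DE 1%:M) => ->; rewrite det1 /mxeval meval0 eq_sym oner_neq0.
have [g] := mxeval_nonroot (mulf_neq0 nz_D nz_f).
rewrite /mxeval mevalM mulf_eq0 negb_or => /andP[nz_Dg nz_fg].
have ug : g \in unitmx by rewrite unitmxE unitfE -DE.
by exists g; last exact: Uf.
Qed.

Lemma generically_and U V :
  generically U -> generically V -> generically (fun g => U g /\ V g).
Proof.
move=> [f [nz_f Uf]] [f' [nz_f' Vf']]; exists (f * f'); split; first exact: mulf_neq0.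
move=> g ug; rewrite /mxeval mevalM mulf_eq0 negb_or => /andP[nz_fg nz_f'g].
by split; [apply: Uf|apply: Vf'].
Qed.

Lemma generically_curve U (A : 'M[{poly K}]_r) s0 :
    map_mx (horner_eval s0) A \in unitmx -> generically U ->
  generically (fun g => exists F : {poly K},
    F != 0 /\ forall s, F.[s] != 0 -> U (g *m map_mx (horner_eval s) A)).
Proof.
move=> uA0 [f [nz_f Uf]]; have [f0 f0E] := mxeval_mulmxr (map_mx (horner_eval s0) A) f.
exists f0; split=> [|g ug nz_f0g].
  have [g nz_fg] := mxeval_nonroot nz_f; apply: contraNneq nz_fg => f0_0.
  have := f0E (g *m invmx (map_mx (horner_eval s0) A)).
  by rewrite mulmxKV // f0_0 /mxeval meval0 => <-.
have [F FE] := mxeval_curve (map_mx polyC g *m A) f.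
have evalE s : map_mx (horner_eval s) (map_mx polyC g *m A)
    = g *m map_mx (horner_eval s) A.
  rewrite map_mxM -map_mx_comp; congr (_ *m _).
  by apply/matrixP => i j; rewrite mxE /= /horner_eval hornerC.
have det_neq0 s : ((\det A).[s] != 0) = (map_mx (horner_eval s) A \in unitmx).
  by rewrite unitmxE det_map_mx unitfE.
exists (\det A * F); split=> [|s].
  suff : (\det A * F).[s0] != 0 by apply: contraNneq => ->; rewrite horner0.
  by rewrite hornerM mulf_neq0 ?det_neq0 // FE evalE -f0E.
rewrite hornerM mulf_eq0 negb_or det_neq0 FE evalE => /andP[uAs nz_fs].
by apply: Uf; rewrite // unitmx_mul ug.
Qed.

End Generic.

(** * Linear changes of coordinates *)

Section LinearChange.
Variable r : nat.
Implicit Types (g h : 'M[CC]_r) (p : {mpoly CC[r]}).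

Let linear_forms g : r.-tuple {mpoly CC[r]} :=
  [tuple \sum_(j < r) g i j *: 'X_j | i < r].

HB.instance Definition _ g :=
  GRing.RMorphism.copy (lin_change g) (comp_mpoly (linear_forms g)).
HB.instance Definition _ g :=
  GRing.Linear.copy (lin_change g) (comp_mpoly (linear_forms g)).

Lemma lin_changeU g i : lin_change g 'X_i = \sum_(j < r) g i j *: 'X_j.
Proof. by rewrite /lin_change comp_mpolyXU -tnth_nth tnth_mktuple. Qed.

Lemma lin_changeX g m : lin_change g 'X_[m] = \prod_i lin_change g 'X_i ^+ m i.
Proof.
by rewrite mpolyXE_id rmorph_prod; apply: eq_bigr => i _; rewrite rmorphXn.
Qed.

Lemma lin_changeE g p :
  lin_change g p = \sum_(m <- msupp p) p@_m *: lin_change g 'X_[m].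
Proof.
by rewrite {1}[p]mpolyE linear_sum; apply: eq_bigr => m _; rewrite linearZ.
Qed.

Lemma lin_change_mulmx g h p : lin_change (g *m h) p = lin_change h (lin_change g p).
Proof.
have mulmxU i : lin_change (g *m h) 'X_i = lin_change h (lin_change g 'X_i).
  rewrite !lin_changeU linear_sum.
  under [RHS]eq_bigr do rewrite linearZ /= lin_changeU scaler_sumr.
  rewrite exchange_big; apply: eq_bigr => l _ /=; rewrite mxE scaler_suml.
  by apply: eq_bigr => j _; rewrite scalerA.
rewrite lin_changeE (lin_changeE g) linear_sum; apply: eq_bigr => m _.
rewrite linearZ /= !lin_changeX rmorph_prod; congr (_ *: _).
by apply: eq_bigr => i _; rewrite rmorphXn mulmxU.
Qed.

Lemma dhomog_lin_change d g p : p \is d.-homog -> lin_change g p \is d.-homog.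
Proof.
move=> hp; rewrite lin_changeE big_seq; apply: rpred_sum => m mp.
rewrite rpredZ // lin_changeX -(dhomog_mf hp mp) /= mdegE.
apply: (big_rec2 (fun (e : nat) q => q \is e.-homog)) => [|i e q _ hq].
  exact: dhomog1.
have /(dhomogMn (m i)) : lin_change g 'X_i \is 1.-homog; last first.
  by rewrite mul1n => hXi; apply: dhomogM.
by rewrite lin_changeU rpred_sum // => j _; rewrite rpredZ // dhomogX /= mdeg1.
Qed.

Lemma homog_gens_lin_change gs g : homog_gens gs -> homog_gens (map (lin_change g) gs).
Proof.
move=> hgs _ /mapP [p /hgs /homogP [d hp] ->]; apply/homogP; exists d.
exact: dhomog_lin_change.
Qed.

Lemma homog_gens_le_lin_change n gs g :
  homog_gens_le n gs -> homog_gens_le n (map (lin_change g) gs).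
Proof.
move=> hgs _ /mapP [p /hgs [d le_dn hp] ->].
by exists d; last exact: dhomog_lin_change.
Qed.

Lemma in_ideal_lin_change gs g p :
  in_ideal gs p -> in_ideal (map (lin_change g) gs) (lin_change g p).
Proof.
move=> /in_idealP [c ->]; apply/in_idealP; exists (fun k => lin_change g (c k)).
rewrite size_map linear_sum; apply: eq_bigr => k _.
by rewrite rmorphM (nth_map 0).
Qed.

Lemma lin_change_diag (d : 'rV[CC]_r) m :
  lin_change (diag_mx d) 'X_[m] = (\prod_i d 0 i ^+ m i) *: 'X_[m].
Proof.
rewrite lin_changeX [in RHS]mpolyXE_id -scaler_prod; apply: eq_bigr => i _.
rewrite -exprZn; congr (_ ^+ _); rewrite lin_changeU (bigD1 i) //= mxE eqxx mulr1n.
by rewrite big1 ?addr0 // => j ne_ji; rewrite mxE eq_sym (negbTE ne_ji) scale0r.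
Qed.

End LinearChange.

Lemma pchar_CC : [pchar CC] =i pred0.
Proof. exact: (@Num.Theory.pchar_num (complex Rdefinitions.R)). Qed.

(** * Shears *)

Definition shear r (k i : 'I_r) : 'M[CC]_r := 1%:M + delta_mx k i.

Definition shear_mnm r (k i : 'I_r) (m : 'X_{1..r}) (a : nat) : 'X_{1..r} :=
  (m - U_(k) *+ a + U_(i) *+ a)%MM.

Section Shear.
Variables (r : nat) (k i : 'I_r).
Hypothesis lt_ik : (i < k)%N.
Implicit Type m : 'X_{1..r}.

Let ne_ki : k == i = false. Proof. by rewrite -val_eqE gtn_eqF. Qed.

Lemma shear_unitmx : shear k i \in unitmx.
Proof.
have [] // := @mulmx1_unit _ _ (shear k i) (1%:M - delta_mx k i).
rewrite mulmxBr mulmx1 mulmxDl mul1mx mul_delta_mx_cond eq_sym ne_ki.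
by rewrite mulr0n addr0 addrK.
Qed.

Lemma lin_change_shearU j :
  lin_change (shear k i) 'X_j = if j == k then 'X_k + 'X_i else 'X_j.
Proof.
rewrite lin_changeU; under eq_bigr do rewrite !mxE scalerDl.
rewrite big_split /= (bigD1 j) //= eqxx scale1r big1 => [|l ne_l]; last first.
  by rewrite eq_sym (negbTE ne_l) scale0r.
rewrite addr0 (bigD1 i) //= eqxx andbT big1 => [|l ne_l]; last first.
  by rewrite (negbTE ne_l) andbF scale0r.
by rewrite addr0; case: eqP => [->|_]; rewrite ?scale1r // scale0r addr0.
Qed.

Lemma lin_change_shear m :
  lin_change (shear k i) 'X_[m]
  = \sum_(a < (m k).+1) 'X_[shear_mnm k i m a] *+ 'C(m k, a).
Proof.
rewrite lin_changeX (bigD1 k) //= lin_change_shearU eqxx.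
under eq_bigr => j /negbTE ne_jk do rewrite lin_change_shearU ne_jk.
rewrite exprDn mulr_suml; apply: eq_bigr => -[a /= lt_a] _.
rewrite mulrnAl mulrAC; congr (_ *+ _).
rewrite [in RHS]mpolyXD -mpolyXn; congr (_ * _).
rewrite [in RHS]mpolyXE_id [in RHS](bigD1 k) //=; congr (_ * _).
  by rewrite mnmBE mulmnE mnm1E eqxx mul1n.
apply: eq_bigr => j ne_jk.
by rewrite mnmBE mulmnE mnm1E eq_sym (negbTE ne_jk) mul0n subn0.
Qed.

Lemma shear_mnm_inj m : injective (shear_mnm k i m).
Proof.
move=> a b /(congr1 (fun m : 'X_{1..r} => m i)).
rewrite /shear_mnm !mnmDE !mnmBE !mulmnE !mnm1E ne_ki eqxx !mul0n !mul1n.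
exact: addnI.
Qed.

Lemma mcoeff_lin_change_shear m a : (a <= m k)%N ->
  (lin_change (shear k i) 'X_[m])@_(shear_mnm k i m a) = 'C(m k, a)%:R.
Proof.
move=> le_a; have lt_a : (a < (m k).+1)%N by [].
rewrite lin_change_shear raddf_sum (bigD1 (Ordinal lt_a)) //=.
rewrite mcoeffMn mcoeffX eqxx big1 ?addr0 // => b ne_ba; rewrite mcoeffMn mcoeffX.
by rewrite (inj_eq (@shear_mnm_inj m)) [_ == a](negbTE ne_ba) mul0rn.
Qed.

Lemma revwt_shear_mnm B m a : (1 < B)%N -> (0 < a <= m k)%N ->
  (revwt B (shear_mnm k i m a) < revwt B m)%N.
Proof.
move=> B1 /andP[a_gt0 le_a].
have mE : m = ((m - U_(k) *+ a) + U_(k) *+ a)%MM.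
  rewrite submK //; apply/mnm_lepP => j; rewrite mulmnE mnm1E.
  by case: eqP => [<-|_]; rewrite ?mul1n ?mul0n.
rewrite [in ltnRHS]mE !revwtD ltn_add2l !revwtMn !revwtU ltn_pmul2l //.
by rewrite ltn_exp2l.
Qed.

Lemma revwt_lin_change_shear B m m' : (1 < B)%N ->
  (lin_change (shear k i) 'X_[m])@_m' != 0 -> m' = m \/ (revwt B m' < revwt B m)%N.
Proof.
move=> B1; rewrite lin_change_shear raddf_sum /=.
have [/existsP [[[|a] /= lt_a] /eqP <-] _|] :=
    boolP [exists a : 'I_(m k).+1, shear_mnm k i m a == m'].
- by left; rewrite /shear_mnm !mulm0n subm0 addm0.
- by right; apply: revwt_shear_mnm.
rewrite negb_exists => /forallP ne_m'; rewrite big1 ?eqxx // => a _.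
by rewrite mcoeffMn mcoeffX (negbTE (ne_m' a)) mul0rn.
Qed.

End Shear.

(** * Degeneration along a torus *)

Definition torus r B (s : CC) : 'M[CC]_r := diag_mx (\row_(j < r) s ^+ (B ^ j)).

Lemma lin_change_torus r B s (m : 'X_{1..r}) :
  lin_change (torus r B s) 'X_[m] = s ^+ revwt B m *: 'X_[m].
Proof.
rewrite lin_change_diag expr_sum; congr (_ *: _).
by apply: eq_bigr => j _; rewrite mxE -exprM mulnC.
Qed.

Definition degeneration r B w (phi : {scalar {mpoly CC[r]}})
    (p : {mpoly CC[r]}) : {poly CC} :=
  \sum_(m <- msupp p) (p@_m * phi 'X_[m]) *: 'X^(revwt B m - w).

Lemma horner_degeneration r B w phi (p : {mpoly CC[r]}) s : p \in revwt_ge B w ->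
  s ^+ w * (degeneration B w phi p).[s] = phi (lin_change (torus r B s) p).
Proof.
move=> /revwt_geP ge_p; rewrite lin_changeE !linear_sum horner_sum mulr_sumr !big_seq.
apply: eq_bigr => m /ge_p le_m; rewrite linearZ /= lin_change_torus linearZ /=.
by rewrite hornerZ hornerXn mulrCA -exprD subnKC // mulrAC mulrA.
Qed.

Lemma horner0_degeneration r B d phi (p : {mpoly CC[r]}) m : (d < B)%N ->
    p \is d.-homog -> lead_mono p m ->
  (degeneration B (revwt B m) phi p).[0] = p@_m * phi 'X_[m].
Proof.
move=> ltdB hp /(lead_monoP ltdB hp) [mp /revwt_geP ge_p].
rewrite horner_sum (bigD1_seq m) ?msupp_uniq //= subnn hornerZ hornerXn expr0 mulr1.
rewrite big_seq_cond big1 ?addr0 // => u /andP[up ne_um].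
rewrite hornerZ hornerXn expr0n subn_eq0 leqNgt ltn_neqAle ge_p // andbT.
case: eqP => [/revwt_inj eq_um|_]; last by rewrite mulr0.
by rewrite eq_um ?eqxx ?(dhomog_mf hp _) in ne_um.
Qed.

Lemma degeneration_unitmx r d N (phi : 'I_N -> {scalar {mpoly CC[r]}})
    (p : 'I_N -> {mpoly CC[r]}) (lead : 'I_N -> 'X_{1..r}) B : (d < B)%N ->
    (forall a, p a \is d.-homog /\ lead_mono (p a) (lead a)) ->
    \matrix_(a, b) phi b 'X_[lead a] \in unitmx ->
  exists D : {poly CC}, D != 0 /\ forall s, D.[s] != 0 ->
    \matrix_(a, b) phi b (lin_change (torus r B s) (p a)) \in unitmx.
Proof.
move=> ltdB lead_p u_lead.
pose A : 'M_N := \matrix_(a, b) degeneration B (revwt B (lead a)) (phi b) (p a).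
have uA0 : \det (map_mx (horner_eval 0) A) != 0.
  have -> : map_mx (horner_eval 0) A
      = diag_mx (\row_a (p a)@_(lead a)) *m \matrix_(a, b) phi b 'X_[lead a].
    apply/matrixP => a b; rewrite mul_diag_mx !mxE; have [hp lead_pa] := lead_p a.
    exact: horner0_degeneration ltdB hp lead_pa.
  rewrite -unitfE -unitmxE unitmx_mul u_lead andbT unitmxE det_diag unitfE.
  by apply/prodf_neq0 => a _; rewrite mxE -mcoeff_msupp; case: (lead_p a) => _ [].
exists ('X * \det A); split=> [|s].
  rewrite mulf_neq0 ?polyX_eq0 //; apply: contraNneq uA0 => detA0.
  by rewrite det_map_mx detA0 rmorph0.
rewrite hornerM hornerX mulf_eq0 negb_or => /andP[nz_s nz_As].
have -> : \matrix_(a, b) phi b (lin_change (torus r B s) (p a))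
    = diag_mx (\row_a s ^+ revwt B (lead a)) *m map_mx (horner_eval s) A.
  apply/matrixP => a b; rewrite mul_diag_mx !mxE; have [hp lead_pa] := lead_p a.
  have [_ ge_pa] := (lead_monoP ltdB hp _).1 lead_pa.
  by rewrite /horner_eval horner_degeneration.
rewrite unitmx_mul !unitmxE det_diag det_map_mx !unitfE nz_As andbT.
by apply/prodf_neq0 => a _; rewrite mxE expf_neq0.
Qed.

(** * Generic initial ideals are strongly stable *)

Lemma mnm_enumeration r d (A : 'X_{1..r} -> Prop) : (forall m, A m -> mdeg m = d) ->
  exists N (E : 'I_N -> 'X_{1..r}), injective E /\ forall m, A m <-> exists a, E a = m.
Proof.
move=> degA; pose P : pred 'X_{1..r < d.+1} := fun m => `[< A m >].
exists #|P|, (fun a => val (enum_val a)); split.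
  by move=> a b /val_inj /enum_val_inj.
move=> m; split=> [Am|[a <-]]; last by apply/asboolP; apply: (enum_valP a).
have lt_m : (mdeg m < d.+1)%N by rewrite degA.
have Pm : BMultinom lt_m \in P by apply/asboolP.
by exists (enum_rank_in Pm (BMultinom lt_m)); rewrite enum_rankK_in.
Qed.

Lemma in_initial_of_coef_unitmx r d (gs : seq {mpoly CC[r]}) N (q : 'I_N -> {mpoly CC[r]})
    (E : 'I_N -> 'X_{1..r}) b0 :
    (forall a, in_ideal gs (q a) /\ q a \is d.-homog) ->
    \matrix_(a, b) (q a)@_(E b) \in unitmx ->
    (forall m, in_initial gs m -> mdeg m = d -> revlex_lt (E b0) m ->
       exists b, E b = m) ->
  in_initial gs (E b0).
Proof.
move=> Iq uA E_above; set A := (X in X \in unitmx) in uA.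
pose p := \sum_a invmx A b0 a *: q a.
have pE b : p@_(E b) = (b0 == b)%:R.
  have := congr1 (fun X : 'M_N => X b0 b) (mulVmx uA); rewrite !mxE => <-.
  by rewrite raddf_sum; apply: eq_bigr => a _ /=; rewrite mcoeffZ [in RHS]mxE.
have Ip : in_ideal gs p by apply: in_ideal_sum => a; apply: in_idealZ; case: (Iq a).
have hp : p \is d.-homog.
  by apply: rpred_sum => a _; rewrite rpredZ //; case: (Iq a).
have b0p : E b0 \in msupp p by rewrite mcoeff_msupp pE eqxx oner_neq0.
have nz_p : p != 0 by apply: contraTneq b0p => ->; rewrite msupp0.
have [m [mp lead_m]] := lead_mono_exists (ltnSn d) hp nz_p.
have Mm : in_initial gs m by exists p.
have [<- //|/eqP ne_m] := eqVneq m (E b0).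
have [b Eb] : exists b, E b = m.
  by apply: E_above => //; [apply: dhomog_mf hp _ mp|apply: lead_m => // /esym].
move: mp; rewrite -Eb mcoeff_msupp pE.
have [eq_b|_] := eqVneq b0 b; last by rewrite eqxx.
by case: ne_m; rewrite -Eb eq_b.
Qed.

Lemma triangular_unitmx (K : fieldType) n (A : 'M[K]_n) (w : 'I_n -> nat) :
    (forall a, A a a != 0) ->
    (forall a b, a != b -> A a b != 0 -> (w b < w a)%N) ->
  A \in unitmx.
Proof.
move=> diag tri; rewrite -unitmx_tr -row_free_unit; apply: inj_row_free => v vA.
have v0 N a : (w a < N)%N -> v 0 a = 0.
  elim: N a => // N IH a lt_aN; have := congr1 (fun x : 'rV_n => x 0 a) vA.
  rewrite !mxE (bigD1 a) //= big1 => [|b ne_ba]; last first.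
    rewrite mxE; have [->|/tri lt_ba] := eqVneq (A a b) 0; first by rewrite mulr0.
    rewrite IH ?mul0r // (leq_trans (lt_ba _)) // 1?eq_sym //.
  by rewrite mxE addr0 => /eqP; rewrite mulf_eq0 (negbTE (diag a)) orbF => /eqP.
by apply/rowP => a; rewrite mxE (v0 (w a).+1).
Qed.

(* The matrix is triangular for the weights of the columns [E]. *)
Lemma shear_coef_unitmx r (i k : 'I_r) m N (E : 'I_N -> 'X_{1..r}) b0 B
    (E' := fun a => if a == b0 then (U_(k) + m)%MM else E a) :
    (i < k)%N -> (1 < B)%N -> injective E -> E b0 = (U_(i) + m)%MM ->
    (forall b, b != b0 -> (revwt B (E b) < revwt B (E b0))%N) ->
  \matrix_(a, b) (lin_change (shear k i) 'X_[E' a])@_(E b) \in unitmx.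
Proof.
move=> lt_ik B1 injE Eb0 lt_E; have km : (0 < (U_(k) + m)%MM k)%N.
  by rewrite mnmDE mnm1E eqxx.
have shear1 : E b0 = shear_mnm k i (U_(k) + m) 1.
  by rewrite Eb0 /shear_mnm !mulm1n [(U_(k) + m)%MM]addmC addmK addmC.
have shear0 u : u = shear_mnm k i u 0 by rewrite /shear_mnm !mulm0n subm0 addm0.
apply: (@triangular_unitmx _ _ _ (fun a => revwt B (E a))) => [a|a b ne_ab].
  rewrite mxE /E'; have [->|_] := eqVneq a b0.
    rewrite shear1 (mcoeff_lin_change_shear lt_ik) // bin1.
    by rewrite (pcharf0P _).1 -?lt0n //; apply: pchar_CC.
  by rewrite [X in _@_X]shear0 (mcoeff_lin_change_shear lt_ik) // bin0 oner_neq0.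
rewrite mxE /E'; have [eq_a|ne_a] := eqVneq a b0.
  by rewrite eq_a lt_E // -eq_a eq_sym.
case/(revwt_lin_change_shear lt_ik B1) => [/injE eq_ba|//].
by rewrite eq_ba eqxx in ne_ab.
Qed.

Lemma in_initial_shear r (gs : seq {mpoly CC[r]}) (i k : 'I_r) m B :
    ((mdeg m).+1 < B)%N -> homog_gens gs -> (i < k)%N ->
    in_initial gs (U_(k) + m) ->
  exists (D : {poly CC}), D != 0 /\ forall s, D.[s] != 0 ->
    let h := torus r B s *m shear k i in
    (forall u, in_initial (map (lin_change h) gs) u <-> in_initial gs u) ->
    in_initial gs (U_(i) + m).
Proof.
pose d := (mdeg m).+1; move=> lt_dB hgs lt_ik Mkm.
have deg_U j : mdeg (U_(j) + m)%MM = d by rewrite mdegD mdeg1.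
have B1 : (1 < B)%N by apply: leq_trans lt_dB.
pose above u := u = (U_(i) + m)%MM \/
  [/\ in_initial gs u, mdeg u = d & revlex_lt (U_(i) + m) u].
have [|N [E [injE aboveE]]] := @mnm_enumeration r d above.
  by move=> u [->|[]].
have [b0 Eb0] : exists b0, E b0 = (U_(i) + m)%MM by apply/aboveE; left.
have E_above b : b != b0 ->
    [/\ in_initial gs (E b), mdeg (E b) = d & revlex_lt (E b0) (E b)].
  move=> ne_b; have /aboveE [] : exists a, E a = E b by exists b.
    by rewrite -Eb0 => /injE eq_b; rewrite eq_b eqxx in ne_b.
  by rewrite Eb0.
pose E' a := if a == b0 then (U_(k) + m)%MM else E a.
have initE' a : in_initial gs (E' a) /\ mdeg (E' a) = d.
  by rewrite /E'; have [_|/E_above []] := eqVneq a b0.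
have /choice [p lift_p] a : exists p, initial_lift gs (E' a) p.
  exact: in_initial_lift hgs (initE' a).1.
have hp a : p a \is d.-homog /\ lead_mono (p a) (E' a).
  by have [_ + lead_p] := lift_p a; rewrite (initE' a).2.
have lt_E b : b != b0 -> (revwt B (E b) < revwt B (E b0))%N.
  by case/E_above => _ deg_b /(@revlex_ltP _ B) -> //; rewrite deg_b // Eb0 deg_U.
have u_shear := shear_coef_unitmx lt_ik B1 injE Eb0 lt_E.
have [D [nz_D uD]] := degeneration_unitmx lt_dB hp
  (phi := fun b => mcoeff (E b) \o lin_change (shear k i)) u_shear.
exists D; split=> // s /uD uQ h Mh; rewrite -Eb0; apply/Mh.
apply: (in_initial_of_coef_unitmx (d := d)) uQ _ => [a|u /Mh Mu deg_u lt_u].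
  have [Ip _ _] := lift_p a; have [hpa _] := hp a.
  rewrite /= -lin_change_mulmx; split; first exact: in_ideal_lin_change.
  exact: dhomog_lin_change.
by apply/aboveE; right; rewrite -Eb0.
Qed.

Lemma map_lin_change_mulmx r (g h : 'M[CC]_r) gs :
  map (lin_change (g *m h)) gs = map (lin_change h) (map (lin_change g) gs).
Proof.
exact: (etrans (eq_map (lin_change_mulmx g h) gs) (map_comp (lin_change h) _ gs)).
Qed.

Lemma gin_strongly_stable r (gs : seq {mpoly CC[r]}) (M : 'X_{1..r} -> Prop) :
  homog_gens gs -> is_gin gs M -> strongly_stable M.
Proof.
move=> hgs ginM i k m lt_ik Mkm; pose B := (mdeg m).+2.
pose A : 'M[{poly CC}]_r := diag_mx (\row_j 'X^(B ^ j)) *m map_mx polyC (shear k i).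
have evalA s : map_mx (horner_eval s) A = torus r B s *m shear k i.
  rewrite map_mxM map_diag_mx -map_mx_comp; congr (diag_mx _ *m _).
    by apply/rowP => j; rewrite !mxE /= /horner_eval hornerXn.
  by apply/matrixP => a b; rewrite mxE /= /horner_eval hornerC.
have uA1 : map_mx (horner_eval 1) A \in unitmx.
  rewrite evalA (_ : torus r B 1 = 1%:M) ?mul1mx ?shear_unitmx //.
  by apply/matrixP => a b; rewrite !mxE expr1n.
have [g ug [Mg [F [nz_F MF]]]] := generically_exists pchar_CC
  (generically_and ginM (generically_curve pchar_CC uA1 ginM)).
have [D [nz_D stableD]] :=
  in_initial_shear (ltnSn _) (homog_gens_lin_change hgs) lt_ik ((Mg _).1 Mkm).
have [s] := char0_poly_nonroot pchar_CC (mulf_neq0 nz_F nz_D).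
rewrite hornerM mulf_eq0 negb_or => /andP[/MF + /stableD stable_s].
rewrite evalA map_lin_change_mulmx => Ms; apply/Mg/stable_s => u.
by split=> [/Ms/Mg|/Mg/Ms].
Qed.

Lemma mul_varE r (i : 'I_r) m : mul_var i m = (U_(i) + m)%MM.
Proof. by apply/mnmP => l; rewrite mnmE mnmDE mnm1E addnC eq_sym. Qed.

Theorem theorem4 (r n : nat) (gs : seq {mpoly CC[r]}) (M : 'X_{1..r} -> Prop) :
  (forall p, p \in gs -> exists d, (d <= n)%N /\ homogeneous_of d p) ->
  is_gin gs M ->
  forall P : 'X_{1..r},
    min_gen M P -> mdeg P = n.+1 ->
    exists (J : 'X_{1..r}) (i : 'I_r),
      [/\ min_gen M J, mdeg J = n,
          (exists k : 'I_r, (i < k)%N /\ (0 < J k)%N)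
        & revlex_lt P (mul_var i J)].
Proof.
move=> /homog_gens_leP hgs ginM P min_P deg_P.
have stM := gin_strongly_stable (homog_gens_leW hgs) ginM.
have [g _ Mg] := generically_exists pchar_CC ginM.
have ME : M = in_initial (map (lin_change g) gs) by apply/predeqP.
rewrite ME in stM min_P *.
have [J [i [min_J deg_J /mnm_max_lePn [k lt_ik Jk] lt_P]]] :=
  min_gen_below_syzygy (homog_gens_le_lin_change hgs) stM min_P deg_P.
by exists J, i; split; rewrite ?mul_varE //; exists k.
Qed.
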